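(* Let $G=(V,E)$ be a locally finite (unweighted) graph and let $k>0$ be a real number such that $\kappa(x,y)\geq k$ for all neighboring vertices $x\sim y$. Then for every function $f:V\to\mathbb{R}$ and every $x\in V$, $$\Gamma_2(f,f)(x)\geq\frac{1}{2}(\Delta f(x))^2+\left(\frac{1}{2}\min_{y:\,y\sim x}\left\{\frac{4}{d_y}+\frac{\lceil k\,(d_x\vee d_y)\rceil}{D(x)}\right\}-1\right)\Gamma(f,f)(x).$$
   Context: Graphs $G=(V,E)$ are undirected, connected, simple, without loops; $V$ may be infinite; locally finite means every vertex has finitely many neighbors. $x\sim y$ means $x,y$ are neighbors, and $d_x$ is the degree (number of neighbors) of $x$. $d$ is the graph distance (number of edges of a shortest path). For each vertex $x$, $m_x$ is the probability measure on $V$ with $m_x(y)=1/d_x$ if $y\sim x$ and $m_x(y)=0$ otherwise. $W_1(\mu_1,\mu_2)=\inf_\xi\sum_{x',y'}d(x',y')\xi(x',y')$, the infimum over all probability measures $\xi$ on $V\times V$ with marginals $\mu_1$ and $\mu_2$. The Ollivier-Ricci curvature is $\kappa(x,y)=1-\frac{W_1(m_x,m_y)}{d(x,y)}$ for $x\neq y$. The Laplace operator is $\Delta f(x)=\frac{1}{d_x}\sum_{y:\,y\sim x}(f(y)-f(x))$. Further, $\Gamma(f,g)=\frac12\{\Delta(fg)-f\Delta g-g\Delta f\}$ and $\Gamma_2(f,g)=\frac12\{\Delta\Gamma(f,g)-\Gamma(f,\Delta g)-\Gamma(\Delta f,g)\}$. $D(x)=\max_{y:\,y\sim x}d_y$,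 $s\vee t=\max(s,t)$, and $\lceil a\rceil=\min\{A\in\mathbb{Z}: A\geq a\}$. *)

(* Defs.v *)
From HB Require Import structures.
From mathcomp Require Import all_boot all_order all_algebra finmap.
From mathcomp Require Import all_classical all_reals all_analysis.

Set Implicit Arguments.
Unset Strict Implicit.
Unset Printing Implicit Defensive.

Import Order.TTheory GRing.Theory Num.Theory.

Local Open Scope classical_set_scope.
Local Open Scope ring_scope.

Record graph := Graph {
  vertex :> choiceType;
  adj : rel vertex;
  adj_sym : symmetric adj;
  adj_irr : irreflexive adj;
  adj_conn : forall x y : vertex, exists p : seq vertex,
    path adj x p /\ last x p = y }.

Section Graph.
Variable G : graph.
Implicit Types x y : G.

Definition nbrs x : set G := [set y | adj x y].

Definition locally_finite := forall x, finite_set (nbrs x).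

(* [fset_set A] enumerates [A] when [A] is finite, and is empty otherwise; it is
   only meaningful below under [locally_finite]. *)
Definition deg x : nat := #|` fset_set (nbrs x)|.

Definition maxdeg x : nat := \max_(y <- fset_set (nbrs x)) deg y.

(* In [path adj x p] the starting vertex [x] is not listed in [p], so [size p]
   is the number of edges. *)
Definition walk_length x y (n : nat) : bool :=
  `[< exists p : seq G, [/\ path (@adj G) x p, last x p = y & size p = n] >].

Lemma walk_length_ex x y : exists n, walk_length x y n.
Proof.
have [p [xp py]] := adj_conn x y.
by exists (size p); apply/asboolP; exists p.
Qed.

Definition dist x y : nat := ex_minn (walk_length_ex x y).

Variable R : realType.
Implicit Types (f g : G -> R).

(* The starting value [F (head x s)] is one of the values being minimised, so
   this is the minimum of [F] over the neighbours of [x]. It is the junk value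
   [F x] only if [x] has no neighbour. *)
Definition min_nbrs x (F : G -> R) : R :=
  let s : seq G := fset_set (nbrs x) in
  \big[Num.min/F (head x s)]_(y <- s) F y.

Definition m x (y : G) : R := if adj x y then (deg x)%:R^-1 else 0.

Definition laplace f x : R :=
  (deg x)%:R^-1 * \sum_(y \in nbrs x) (f y - f x).

Definition Gamma f g x : R :=
  2^-1 * (laplace (fun z => f z * g z) x - f x * laplace g x - g x * laplace f x).

Definition Gamma2 f g x : R :=
  2^-1 * (laplace (Gamma f g) x - Gamma f (laplace g) x - Gamma (laplace f) g x).

Local Open Scope ereal_scope.

(* Probability measures on the discrete spaces [V] and [V * V] are given by
   their mass functions. *)
Definition is_prob (T : choiceType) (mu : T -> R) : Prop :=
  (forall t, (0 <= mu t)%R) /\ \esum_(t in [set: T]) (mu t)%:E = 1.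

Definition coupling (mu1 mu2 : G -> R) : set (G * G -> R) :=
  [set xi | [/\ is_prob xi,
    forall x, \esum_(y in [set: G]) (xi (x, y))%:E = (mu1 x)%:E &
    forall y, \esum_(x in [set: G]) (xi (x, y))%:E = (mu2 y)%:E]].

Definition W1 (mu1 mu2 : G -> R) : \bar R :=
  ereal_inf [set \esum_(p in [set: G * G]) ((dist p.1 p.2)%:R * xi p)%:E
            | xi in coupling mu1 mu2].

Definition kappa x y : \bar R := 1 - W1 (m x) (m y) / (dist x y)%:R%:E.

End Graph.

(* Main.v *)
Require Import Defs.
From HB Require Import structures.
From mathcomp Require Import all_boot all_order all_algebra finmap.
From mathcomp Require Import all_classical all_reals all_analysis.
From mathcomp Require Import ring lra.

Set Implicit Arguments.
Unset Strict Implicit.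
Unset Printing Implicit Defensive.

Import Order.TTheory GRing.Theory Num.Theory.
Local Open Scope ring_scope.

(** The proof has an analytic half and a combinatorial half, which meet in the
    number [triangles x y] of common neighbours of two adjacent vertices.

    Analytic half.  Expanding [Gamma2] gives a discrete Bochner formula
    ([Gamma2_bochner]): up to [- Gamma + (laplace f) ^ 2 / 2], [Gamma2 f f x] is
    a quarter of the average, over two-step walks x ~ y ~ z, of the squared
    second difference (f x - 2 f y + f z) ^ 2.  Every walk contributes
    nonnegatively, so a lower bound follows by keeping only some of them.  Write
    b y = f y - f x.  Walks returning to z = x contribute 4 (b y) ^ 2 / d_y.
    Walks ending at a common neighbour z of x and y contribute
    (b z - 2 b y) ^ 2 / d_y, which is at least (b z - 2 b y) ^ 2 / D(x).  One such
    term may vanish, but the walks x ~ y ~ z and x ~ z ~ y come in pairs, and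
    (b z - 2 b y) ^ 2 + (b y - 2 b z) ^ 2
      = (b y) ^ 2 + (b z) ^ 2 + 4 (b y - b z) ^ 2.
    Hence triangles contribute at least triangles x y * (b y) ^ 2 / D(x) for each
    y ([sum_mean_hess_ge]).

    Combinatorial half.  Mass transported between distinct points travels
    distance at least 1, and a coupling of two measures leaves in place at most
    their pointwise minimum; so W1 is at least 1 minus the mass of that minimum
    ([W1_ge]).  For m_x and m_y this common mass is
    triangles x y / max(d_x, d_y), whence k max(d_x, d_y) <= triangles x y.  As
    the right-hand side is an integer, the left-hand side may be rounded up
    ([ceil_le_triangles]). *)

(** * Averages over neighbours *)

Definition nbhd (G : graph) (x : G) : {fset G} := fset_set (nbrs x).

Definition triangles (G : graph) (x y : G) : nat := count (adj y) (nbhd x).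

(** At an isolated vertex this is 0, because 0^-1 = 0; the Laplacian has the
    same convention, so that [laplaceE] and [GammaE] hold at every vertex. *)
Definition mean (R : realType) (G : graph) (x : G) (F : G -> R) : R :=
  (deg x)%:R^-1 * \sum_(y <- nbhd x) F y.

Lemma mem_nbhd (G : graph) (G_lf : locally_finite G) (x y : G) :
  (y \in nbhd x) = adj x y.
Proof.
rewrite /nbhd in_fset_set; last exact: G_lf.
by apply/idP/idP; rewrite inE.
Qed.

Lemma deg_gt0 (G : graph) (G_lf : locally_finite G) (x y : G) :
  adj x y -> (0 < deg x)%N.
Proof. by rewrite -(mem_nbhd G_lf) cardfs_gt0 => xy; apply/fset0Pn; exists y. Qed.

Lemma eq_mean (R : realType) (G : graph) (G_lf : locally_finite G) (x : G)
    (F F' : G -> R) :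
  (forall y, adj x y -> F y = F' y) -> mean x F = mean x F'.
Proof.
move=> FF'; congr (_ * _); apply: eq_big_seq => y.
by rewrite (mem_nbhd G_lf); apply: FF'.
Qed.

Lemma meanD (R : realType) (G : graph) (x : G) (F F' : G -> R) :
  mean x (fun y => F y + F' y) = mean x F + mean x F'.
Proof. by rewrite /mean big_split mulrDr. Qed.

Lemma meanZ (R : realType) (G : graph) (x : G) (c : R) (F : G -> R) :
  mean x (fun y => c * F y) = c * mean x F.
Proof. by rewrite /mean -big_distrr mulrCA. Qed.

Lemma sumr1_nbhd (R : realType) (G : graph) (x : G) :
  \sum_(y <- nbhd x) 1 = (deg x)%:R :> R.
Proof. by rewrite big_const_seq count_predT iter_addr_0. Qed.

Lemma mean_cst (R : realType) (G : graph) (x : G) (c : R) :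
  (0 < deg x)%N -> mean x (fun=> c) = c.
Proof.
move=> dx; have -> : (fun=> c) = (fun _ : G => c * 1) by rewrite mulr1.
by rewrite meanZ /mean sumr1_nbhd mulVf ?mulr1 // pnatr_eq0 -lt0n.
Qed.

(** Unlike [mean_cst], this also holds at an isolated vertex, where both sides
    are 0; it spares the Bochner formula a case distinction on the degree. *)
Lemma mean_idem (R : realType) (G : graph) (x : G) (F : G -> R) :
  mean x (fun=> mean x F) = mean x F.
Proof.
have [dx|dx] := posnP (deg x); first by rewrite /mean dx invr0 !mul0r.
by rewrite mean_cst.
Qed.

(** * The Bochner formula *)

Lemma laplaceE (R : realType) (G : graph) (G_lf : locally_finite G)
    (f : G -> R) (x : G) :
  laplace f x = mean x (fun y => f y - f x).
Proof. by rewrite /laplace fsbig_finite. Qed.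

(** The carre du champ form of [Gamma], from
    (f y - f x) (g y - g x) = f y g y - f x g x - f x (g y - g x) - g x (f y - f x). *)
Lemma GammaE (R : realType) (G : graph) (G_lf : locally_finite G)
    (f g : G -> R) (x : G) :
  Gamma f g x = 2^-1 * mean x (fun y => (f y - f x) * (g y - g x)).
Proof.
congr (_ * _); rewrite !(laplaceE G_lf) -!mulNr -!meanZ -!meanD.
by apply: (eq_mean G_lf) => y _; ring.
Qed.

(** The second difference is (f z - f y) - (f y - f x).  Averaging its square
    over z gives 2 Gamma f f y - 2 (f y - f x) laplace f y + (f y - f x) ^ 2;
    averaging that over y produces the terms of laplace (Gamma f f) and of
    Gamma f (laplace f). *)
Lemma Gamma2_bochner (R : realType) (G : graph) (G_lf : locally_finite G)
    (f : G -> R) (x : G) :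
  Gamma2 f f x =
    4^-1 * mean x (fun y => mean y (fun z => (f x - 2 * f y + f z) ^+ 2))
    - Gamma f f x + 2^-1 * laplace f x ^+ 2.
Proof.
have hess y : adj x y -> mean y (fun z => (f x - 2 * f y + f z) ^+ 2) =
    2 * Gamma f f y + (-2) * ((f y - f x) * laplace f y)
    + (f y - f x) * (f y - f x).
  move=> xy; have dy : (0 < deg y)%N by apply: (deg_gt0 G_lf (y := x)); rewrite adj_sym.
  rewrite (GammaE G_lf) (laplaceE G_lf) mulrA mulfV ?pnatr_eq0 // mul1r.
  rewrite mulrA -[(f y - f x) * (f y - f x)](mean_cst _ dy).
  by rewrite -meanZ -!meanD; apply: (eq_mean G_lf) => z _; ring.
rewrite (eq_mean G_lf hess) !meanD.
rewrite (meanZ x 2 (Gamma f f)) (meanZ x (-2)).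
have lapGamma : laplace (Gamma f f) x = mean x (Gamma f f) - Gamma f f x.
  rewrite (laplaceE G_lf) meanD; congr (_ + _).
  rewrite (GammaE G_lf f f x) -mulNr meanZ mean_idem; ring.
have Gammaflap : Gamma f (laplace f) x =
    2^-1 * (mean x (fun y => (f y - f x) * laplace f y) - laplace f x ^+ 2).
  rewrite (GammaE G_lf); congr (_ * _).
  rewrite expr2 {3}(laplaceE G_lf) -[- (laplace f x * _)]mulNr -meanZ -meanD.
  by apply: (eq_mean G_lf) => y _; ring.
have GammaC : Gamma (laplace f) f x = Gamma f (laplace f) x.
  rewrite !(GammaE G_lf); congr (_ * _).
  by apply: (eq_mean G_lf) => y _; rewrite mulrC.
rewrite /Gamma2 lapGamma GammaC Gammaflap (GammaE G_lf f f x); by field.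
Qed.

(** * The contribution of the triangles *)

Lemma big_common_nbhd (R : realType) (G : graph) (G_lf : locally_finite G)
    (x y : G) (F : G -> R) :
  \sum_(z <- nbhd y | adj x z) F z = \sum_(z <- nbhd x | adj y z) F z.
Proof.
rewrite -big_filter -[RHS]big_filter; apply: perm_big; apply: uniq_perm.
- by rewrite filter_uniq.
- by rewrite filter_uniq.
- by move=> z; rewrite !mem_filter !(mem_nbhd G_lf) andbC.
Qed.

(** Exchanging y and z reverses the closed walk x ~ y ~ z ~ x. *)
Lemma triangle_sumC (R : realType) (G : graph) (x : G) (F : G -> G -> R) :
  \sum_(y <- nbhd x) \sum_(z <- nbhd x | adj y z) F z y =
  \sum_(y <- nbhd x) \sum_(z <- nbhd x | adj y z) F y z.
Proof.
rewrite (exchange_big_dep xpredT) //=; apply: eq_bigr => y _.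
by apply: eq_bigl => z; rewrite adj_sym.
Qed.

(** A single term may vanish (when b z = 2 b y), so the bound needs the symmetry
    in y and z.  In
    (b z - 2 b y) ^ 2 = 2 (b y - b z) ^ 2 + (2 (b y) ^ 2 - (b z) ^ 2)
    the first summand is dropped, and the second sums, by symmetry, to the same
    value as (b y) ^ 2. *)
Lemma triangle_sum_ge (R : realType) (G : graph) (x : G) (b : G -> R) :
  \sum_(y <- nbhd x) (triangles x y)%:R * b y ^+ 2 <=
  \sum_(y <- nbhd x) \sum_(z <- nbhd x | adj y z) (b z - 2 * b y) ^+ 2.
Proof.
have -> : \sum_(y <- nbhd x) (triangles x y)%:R * b y ^+ 2 =
    \sum_(y <- nbhd x) \sum_(z <- nbhd x | adj y z) (2 * b y ^+ 2 - b z ^+ 2).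
  under [RHS]eq_bigr do rewrite sumrB.
  rewrite sumrB (triangle_sumC x (fun y _ => b y ^+ 2)) -sumrB.
  apply: eq_bigr => y _; rewrite -sumrB.
  rewrite /triangles -sum1_count natr_sum mulr_suml; apply: eq_bigr => z _; ring.
apply: ler_sum => y _; apply: ler_sum => z _.
rewrite -subr_ge0 [X in 0 <= X](_ : _ = 2 * (b y - b z) ^+ 2); last by ring.
by rewrite mulr_ge0 // sqr_ge0.
Qed.

Lemma deg_le_maxdeg (G : graph) (G_lf : locally_finite G) (x y : G) :
  adj x y -> (deg y <= maxdeg x)%N.
Proof. by rewrite -(mem_nbhd G_lf) => xy; apply: leq_bigmax_seq. Qed.

(** Of the walks x ~ y ~ z, only those with z = x, which give the first summand,
    and those with z adjacent to x, which give the second, are kept. *)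
Lemma mean_hess_ge (R : realType) (G : graph) (G_lf : locally_finite G)
    (f : G -> R) (x y : G) :
  adj x y ->
  4 / (deg y)%:R * (f y - f x) ^+ 2 + (maxdeg x)%:R^-1 *
    \sum_(z <- nbhd x | adj y z) ((f z - f x) - 2 * (f y - f x)) ^+ 2 <=
  mean y (fun z => (f x - 2 * f y + f z) ^+ 2).
Proof.
move=> xy; have yx : adj y x by rewrite adj_sym.
have dy : (0 < deg y)%N := deg_gt0 G_lf yx.
rewrite /mean [X in _ <= _ * X](bigID (adj x)) /=.
rewrite (big_common_nbhd G_lf x y) [leRHS]mulrDr [leRHS]addrC.
apply: lerD.
  rewrite [4 / _]mulrC -mulrA ler_wpM2l ?invr_ge0 ?ler0n //.
  (* As adj x x is false, the term z = x lies in the non-adjacent part. *)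
  rewrite (big_rem x) /=; last by rewrite (mem_nbhd G_lf).
  rewrite adj_irr /= [X in X <= _](_ : _ = (f x - 2 * f y + f x) ^+ 2); last by ring.
  by rewrite lerDl sumr_ge0 // => z _; rewrite sqr_ge0.
rewrite [X in _ * X <= _](_ : _ =
    \sum_(z <- nbhd x | adj y z) (f x - 2 * f y + f z) ^+ 2); last first.
  by apply: eq_bigr => z _; congr (_ ^+ 2); ring.
apply: ler_wpM2r; first by apply: sumr_ge0 => z _; rewrite sqr_ge0.
have le_d := deg_le_maxdeg G_lf xy.
by rewrite lef_pV2 ?posrE ?ltr0n ?ler_nat // (leq_trans dy).
Qed.

Lemma sum_mean_hess_ge (R : realType) (G : graph) (G_lf : locally_finite G)
    (f : G -> R) (x : G) :
  \sum_(y <- nbhd x)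
    (4 / (deg y)%:R + (triangles x y)%:R / (maxdeg x)%:R) * (f y - f x) ^+ 2 <=
  \sum_(y <- nbhd x) mean y (fun z => (f x - 2 * f y + f z) ^+ 2).
Proof.
apply: (@le_trans _ _ (\sum_(y <- nbhd x)
  (4 / (deg y)%:R * (f y - f x) ^+ 2 + (maxdeg x)%:R^-1 *
    \sum_(z <- nbhd x | adj y z) ((f z - f x) - 2 * (f y - f x)) ^+ 2))).
  rewrite [leLHS](_ : _ = \sum_(y <- nbhd x) (4 / (deg y)%:R * (f y - f x) ^+ 2 +
      (maxdeg x)%:R^-1 * ((triangles x y)%:R * (f y - f x) ^+ 2))); last first.
    by apply: eq_bigr => y _; ring.
  rewrite !big_split /= lerD2l -!mulr_sumr ler_wpM2l ?invr_ge0 ?ler0n //.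
  exact: (triangle_sum_ge x (fun y => f y - f x)).
rewrite big_seq_cond [leRHS]big_seq_cond.
apply: ler_sum => y; rewrite andbT (mem_nbhd G_lf).
exact: mean_hess_ge.
Qed.

(** * Common mass bounds the transport distance *)

Lemma dist_neq_ge1 (G : graph) (x y : G) : x != y -> (1 <= dist x y)%N.
Proof.
move=> xy; rewrite /dist; case: ex_minnP => n /asboolP[p [_ pl ps]] _.
by case: p pl ps => [/= /eqP|z p _ <- //]; rewrite (negPf xy).
Qed.

Lemma dist_adj (G : graph) (x y : G) : adj x y -> dist x y = 1%N.
Proof.
move=> xy; have xNy : x != y by apply: contraTneq xy => ->; rewrite adj_irr.
apply/eqP; rewrite eqn_leq dist_neq_ge1 // andbT /dist.
case: ex_minnP => n _; apply; apply/asboolP.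
by exists [:: y]; split => //=; rewrite xy.
Qed.

Lemma esum_diag (R : realType) (T : choiceType) (xi : T * T -> R) :
  (forall p, 0 <= xi p) ->
  (\esum_(p in [set: T * T]) (if p.1 == p.2 then (xi p)%:E else 0) =
   \esum_(z in [set: T]) (xi (z, z))%:E)%E.
Proof.
move=> xi0; pose a (z w : T) := if z == w then (xi (z, w))%:E else 0%E.
have a0 z w : (0 <= a z w)%E by rewrite /a; case: ifP => // _; rewrite lee_fin.
have -> : [set: T * T]%classic = (setT `*`` (fun=> setT))%classic.
  by apply/seteqP; split.
transitivity (\esum_(p in (setT `*`` (fun=> setT))%classic) a p.1 p.2)%E.
  by apply: eq_esum => -[z w] _.
rewrite -esum_esum //; apply: eq_esum => z _.
rewrite -[RHS](@esum_set1 R T z (fun w => (xi (z, w))%:E)) ?lee_fin //.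
rewrite [RHS]esum_mkcond; apply: eq_esum => w _.
have -> : (w \in [set z]%classic) = (w == z) by apply/idP/eqP; rewrite inE.
by rewrite /a eq_sym.
Qed.

Lemma esum_ge_term (R : realType) (T : choiceType) (a : T -> \bar R) (t : T) :
  (forall s, 0 <= a s)%E -> (a t <= \esum_(s in [set: T]) a s)%E.
Proof.
move=> a0; apply: esum_ge; exists [set t]%classic; first by split.
by rewrite fsbig_set1.
Qed.

Lemma coupling_diag_le (R : realType) (G : graph) (mu1 mu2 : G -> R)
    (xi : G * G -> R) (z : G) :
  coupling mu1 mu2 xi -> xi (z, z) <= Num.min (mu1 z) (mu2 z).
Proof.
move=> [[xi0 _] xi1 xi2]; rewrite le_min -!lee_fin -xi1 -xi2.
apply/andP; split.
  by apply: (@esum_ge_term R G (fun w => (xi (z, w))%:E)) => w; rewrite lee_fin.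
by apply: (@esum_ge_term R G (fun w => (xi (w, z))%:E)) => w; rewrite lee_fin.
Qed.

(** The unit mass of a coupling splits into its diagonal part, at most c by
    [coupling_diag_le], and its off-diagonal part, whose cost is at least its
    mass.  The bound is stated with a real c, rather than with the sum itself, to
    keep the subtraction finite. *)
Lemma W1_ge (R : realType) (G : graph) (mu1 mu2 : G -> R) (c : R) :
  (\esum_(z in [set: G]) (Num.min (mu1 z) (mu2 z))%:E <= c%:E)%E ->
  ((1 - c)%:E <= W1 mu1 mu2)%E.
Proof.
move=> le_c; apply: le_ereal_inf_tmp => _ [xi cpl <-].
have [[xi0 xi_1] _ _] := cpl.
(* The diagonal mass is added to the cost so that only sums of nonnegative
   families occur. *)
rewrite EFinB leeBlDr // -xi_1.
apply: (@le_trans _ _ (\esum_(p in [set: G * G])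
  (((dist p.1 p.2)%:R * xi p)%:E + (if p.1 == p.2 then (xi p)%:E else 0)))%E).
  apply: le_esum => -[z w] _ /=; case: eqVneq => [_|zw].
    by rewrite leeDr // lee_fin mulr_ge0.
  by rewrite adde0 lee_fin ler_peMl // ler1n dist_neq_ge1.
rewrite esumD; last 2 first.
- by move=> p _; rewrite lee_fin mulr_ge0.
- by move=> p _; case: ifP => // _; rewrite lee_fin.
apply: leeD2l; rewrite esum_diag //; apply: le_trans le_c.
by apply: le_esum => z _; rewrite lee_fin coupling_diag_le.
Qed.

(** Both measures are uniform, so their minimum is 1 / max(d_x, d_y) on the
    common neighbours and vanishes elsewhere. *)
Lemma esum_min_m (R : realType) (G : graph) (G_lf : locally_finite G) (x y : G) :
  adj x y ->
  (\esum_(z in [set: G]) (Num.min (m R x z) (m R y z))%:E =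
   ((triangles x y)%:R / (maxn (deg x) (deg y))%:R)%:E)%E.
Proof.
move=> xy; have dx := deg_gt0 G_lf xy.
have dy : (0 < deg y)%N by apply: (deg_gt0 G_lf (y := x)); rewrite adj_sym.
set c : R := (maxn _ _)%:R^-1.
transitivity (\esum_(z in nbrs x) (if adj y z then c else 0)%:E)%E.
  rewrite [RHS]esum_mkcond; apply: eq_esum => z _.
  have -> : (z \in nbrs x) = adj x z by apply/idP/idP; rewrite inE.
  rewrite /m; case: (adj x z); case: (adj y z) => /=.
  - congr EFin; rewrite /c /maxn; case: ltnP => xy_deg.
      by apply/min_idPr; rewrite lef_pV2 ?posrE ?ltr0n // ler_nat ltnW.
    by apply/min_idPl; rewrite lef_pV2 ?posrE ?ltr0n // ler_nat.
  - by congr EFin; apply/min_idPr; rewrite invr_ge0 ler0n.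
  - by congr EFin; apply/min_idPl; rewrite invr_ge0 ler0n.
  - by rewrite minxx.
rewrite esum_fset; last 2 first.
- exact: G_lf.
- by move=> z _; rewrite lee_fin; case: ifP => // _; rewrite invr_ge0 ler0n.
rewrite fsbig_finite; last exact: G_lf.
rewrite /= sumEFin -big_mkcond /= /triangles -sum1_count natr_sum mulr_suml.
by congr EFin; apply: eq_bigr => z _; rewrite mul1r.
Qed.

(** * The curvature inequality *)

Lemma ceil_le_triangles (R : realType) (G : graph) (G_lf : locally_finite G)
    (k : R) (x y : G) :
  adj x y -> (k%:E <= kappa R x y)%E ->
  (Num.ceil (k * (maxn (deg x) (deg y))%:R))%:~R <= (triangles x y)%:R :> R.
Proof.
move=> xy; set M := maxn _ _ => k_le.
have M_gt0 : 0 < M%:R :> R by rewrite ltr0n leq_max (deg_gt0 G_lf xy).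
suff k_leM : k <= (triangles x y)%:R / M%:R.
  rewrite -[X in _ <= X]mulrz_nat ler_int ceil_le_int mulrz_nat.
  by rewrite -ler_pdivlMr.
have : ((1 - (triangles x y)%:R / M%:R)%:E <= W1 (m R x) (m R y))%E.
  by apply: W1_ge; rewrite esum_min_m.
move: k_le; rewrite /kappa dist_adj // inve1 mule1.
case: (W1 _ _) => [w| |] //=; rewrite -?EFinB !lee_fin; lra.
Qed.

Theorem corollary3 (R : realType) (G : graph) (k : R)
  (G_lf : locally_finite G) (k_gt0 : 0 < k)
  (kappa_ge : forall x y : G, adj x y -> (k%:E <= kappa R x y)%E)
  (f : G -> R) (x : G) :
  Gamma2 f f x >=
    2^-1 * laplace f x ^+ 2
    + (2^-1 * min_nbrs x (fun y =>
           4 / (deg y)%:R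
           + (Num.ceil (k * (maxn (deg x) (deg y))%:R))%:~R / (maxdeg x)%:R)
       - 1) * Gamma f f x.
Proof.
set F := fun y : G => _ + _; set t := min_nbrs x F.
suff : t * mean x (fun y => (f y - f x) ^+ 2) <=
    mean x (fun y => mean y (fun z => (f x - 2 * f y + f z) ^+ 2)).
  rewrite (Gamma2_bochner G_lf) (GammaE G_lf f f x).
  have -> : mean x (fun y => (f y - f x) * (f y - f x)) =
      mean x (fun y => (f y - f x) ^+ 2).
    by apply: (eq_mean G_lf) => y _; rewrite expr2.
  lra.
rewrite /mean mulrCA ler_wpM2l ?invr_ge0 ?ler0n //.
apply: le_trans (sum_mean_hess_ge G_lf f x).
rewrite mulr_sumr big_seq_cond [leRHS]big_seq_cond.
apply: ler_sum => y; rewrite andbT => xy.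
rewrite ler_wpM2r ?sqr_ge0 //.
apply: (@le_trans _ _ (F y)); first exact: ge_bigmin_seq.
rewrite lerD2l ler_wpM2r ?invr_ge0 ?ler0n //.
by rewrite (mem_nbhd G_lf) in xy; apply: (ceil_le_triangles G_lf xy); apply: kappa_ge.
Qed.
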